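(* Let $\mathbf V$ be a congruence-modular variety of algebras, $A\in\mathbf V$, and $M\in\mathrm{Ab}[A,\mathbf V]$. If $\langle\chi,E,\pi\rangle$ is an abelian extension in $\mathbf V$ of $A$ by $M$, and $e,e',e''\in E$ are such that $\pi(e)=\pi(e')=\pi(e'')$, then $${}_e\chi^{-1}(e')+{}_{e'}\chi^{-1}(e'')={}_e\chi^{-1}(e''),$$ where the sum is taken in the abelian group ${}_{\pi(e)}M$.
   Context: Algebras may be empty. Let $A\in\mathbf V$. An $A$-set $S$ is a family of sets $({}_aS)_{a\in A}$; an $A$-function $f:S\to S'$ is a family of functions ${}_af:{}_aS\to{}_aS'$; for $\mathbf a\in A^n$ put ${}_{\mathbf a}S={}_{a_1}S\times\cdots\times{}_{a_n}S$. An $A$-overalgebra $Q$ is an $A$-set with, for each $n$-ary basic operation $\omega$ and $\mathbf a\in A^n$, a function $\omega^Q_{\mathbf a}:{}_{\mathbf a}Q\to{}_{\omega(\mathbf a)}Q$; homomorphisms are $A$-functions commuting with these. Its total algebra $A\ltimes Q$ is the set of pairs $\langle a,q\rangle$ ($a\in A$, $q\in{}_aQ$) with $\omega(\langle a_1,q_1\rangle,\ldots,\langle a_n,q_n\rangle)=\langle\omega(\mathbf a),\omega^Q_{\mathbf a}(\mathbf q)\rangle$; $Q$ is totally in $\mathbf V$ if $A\ltimes Q\in\mathbf V$. A pointed $A$-overalgebra has a basepoint in each ${}_aP$, preserved by all $\omega^P_{\mathbf a}$; homomorphisms preserve basepoints. An abelian group $A$-overalgebra $M$ has an abelian group structure on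 each ${}_aM$ such that all $\omega^M_{\mathbf a}$ are group homomorphisms (on the product group ${}_{\mathbf a}M$); it is pointed by the zeros ${}_a0$. $\mathrm{Ab}[A,\mathbf V]$ is the category of abelian group $A$-overalgebras totally in $\mathbf V$, with overalgebra homomorphisms that are group homomorphisms componentwise. For a homomorphism $f:X\to A$, ${}_f\mathrm{Res}\,M$ is the $X$-overalgebra with ${}_x({}_f\mathrm{Res}\,M)={}_{f(x)}M$ and operations $\omega^{{}_f\mathrm{Res}M}_{\mathbf x}=\omega^M_{f(\mathbf x)}$. For a congruence $\kappa$ of $E$, $\kappa^*$ is the pointed $E$-overalgebra with ${}_e\kappa^*=\{e':e\mathrel\kappa e'\}$, basepoint $e\in{}_e\kappa^*$, and $\omega^{\kappa^*}_{\mathbf e}(\mathbf c)=\omega(\mathbf c)$. An (abelian) extension in $\mathbf V$ of $A$ by $M$ is a triple $\langle\chi,E,\pi\rangle$ with $E\in\mathbf V$, $\pi:E\to A$ an onto homomorphism, and $\chi:{}_\pi\mathrm{Res}\,M\to\kappa^*$ an isomorphism of pointed $E$-overalgebras, where $\kappa=\ker\pi$ is the kernel congruence. Thus ${}_e\chi:{}_{\pi(e)}M\to\pi^{-1}(\pi(e))$ is a bijection for each $e\in E$, and ${}_e\chi^{-1}$ denotes its inverse. *)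

(* Defs.v *)
From Stdlib Require Import RelationClasses.
From mathcomp Require Import all_boot all_algebra boolp.

Set Implicit Arguments.
Unset Strict Implicit.
Unset Printing Implicit Defensive.

Import GRing.Theory.
Local Open Scope ring_scope.

(* Finitary signatures; nullary operations are allowed. *)
Record signature := Signature {
  op :> Type;
  arity : op -> nat }.

(* Algebras may be empty. *)
Record algebra (S : signature) := Algebra {
  carrier :> Type;
  interp : forall o : S, ('I_(arity o) -> carrier) -> carrier }.
Arguments interp {S a} o x.

Record hom (S : signature) (X A : algebra S) := Hom {
  hom_fun :> X -> A;
  hom_op : forall (o : S) (x : 'I_(arity o) -> X),
    hom_fun (interp o x) = interp o (fun i => hom_fun (x i)) }.

(* Identities are finitary, so countably many variables suffice. *)
Inductive term (S : signature) : Type :=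
| Var of nat
| App (o : S) of ('I_(arity o) -> term S).

Fixpoint eval (S : signature) (A : algebra S) (v : nat -> A) (t : term S) : A :=
  match t with
  | Var n => v n
  | App o ts => interp o (fun i => eval v (ts i))
  end.

Definition satisfies (S : signature) (A : algebra S) (s t : term S) : Prop :=
  forall v : nat -> A, eval v s = eval v t.

Definition variety (S : signature) (V : algebra S -> Prop) : Prop :=
  exists Sigma : term S -> term S -> Prop,
    forall A : algebra S, V A <-> forall s t, Sigma s t -> satisfies A s t.

Record congruence (S : signature) (E : algebra S) := Congruence {
  cong_rel :> E -> E -> Prop;
  cong_equiv : Equivalence cong_rel;
  cong_op : forall (o : S) (x y : 'I_(arity o) -> E),
    (forall i, cong_rel (x i) (y i)) -> cong_rel (interp o x) (interp o y) }.

Section CongruenceLattice.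
Variables (S : signature) (E : algebra S).
Implicit Types R T U : congruence E.

Definition cong_le R T : Prop := forall x y, R x y -> T x y.

Lemma meet_equiv R T : Equivalence (fun x y => R x y /\ T x y).
Proof.
have [rR sR tR] := cong_equiv R; have [rT sT tT] := cong_equiv T.
split=> [x|x y [? ?]|x y z [? ?] [? ?]]; split; by eauto.
Qed.

Lemma meet_op R T (o : S) (x y : 'I_(arity o) -> E) :
  (forall i, R (x i) (y i) /\ T (x i) (y i)) ->
  R (interp o x) (interp o y) /\ T (interp o x) (interp o y).
Proof. by move=> xy; split; apply: cong_op => i; case: (xy i). Qed.

Definition cong_meet R T : congruence E :=
  Congruence (meet_equiv R T) (@meet_op R T).

Definition join_rel R T (x y : E) : Prop :=
  forall U, cong_le R U -> cong_le T U -> U x y.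

Lemma join_equiv R T : Equivalence (join_rel R T).
Proof.
split=> [x U _ _|x y xy U RU TU|x y z xy yz U RU TU];
  have [rU sU tU] := cong_equiv U; [exact: rU | exact/sU/xy |].
by apply: (tU _ y); [apply: xy | apply: yz].
Qed.

Lemma join_op R T (o : S) (x y : 'I_(arity o) -> E) :
  (forall i, join_rel R T (x i) (y i)) ->
  join_rel R T (interp o x) (interp o y).
Proof. by move=> xy U RU TU; apply: cong_op => i; apply: xy. Qed.

Definition cong_join R T : congruence E :=
  Congruence (join_equiv R T) (@join_op R T).

Definition modular_congruences : Prop :=
  forall R T U, cong_le R U ->
    forall x y, cong_join R (cong_meet T U) x y <->
                cong_meet (cong_join R T) U x y.

End CongruenceLattice.

Definition congruence_modular (S : signature) (V : algebra S -> Prop) : Prop :=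
  forall E : algebra S, V E -> modular_congruences E.

Section Kernel.
Variables (S : signature) (X A : algebra S) (f : hom X A).

Lemma kernel_equiv : Equivalence (fun x y => f x = f y).
Proof. by split=> [x|x y ->|x y z -> ->]. Qed.

Lemma kernel_op (o : S) (x y : 'I_(arity o) -> X) :
  (forall i, f (x i) = f (y i)) -> f (interp o x) = f (interp o y).
Proof.
move=> xy; rewrite !hom_op; congr (interp o _).
by apply: functional_extensionality_dep => i.
Qed.

Definition kernel : congruence X := Congruence kernel_equiv kernel_op.

End Kernel.

Record overalgebra (S : signature) (A : algebra S) := Overalgebra {
  fib :> A -> Type;
  oop : forall (o : S) (a : 'I_(arity o) -> A),
    (forall i, fib (a i)) -> fib (interp o a) }.

Definition total_algebra (S : signature) (A : algebra S) (Q : overalgebra A) :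
    algebra S :=
  @Algebra S {a : A & Q a} (fun o x =>
    existT Q (interp o (fun i => projT1 (x i)))
             (oop (fun i => projT2 (x i)))).

Definition totally_in (S : signature) (V : algebra S -> Prop)
    (A : algebra S) (Q : overalgebra A) : Prop :=
  V (total_algebra Q).

Record pointed_overalgebra (S : signature) (A : algebra S) :=
  PointedOveralgebra {
    pov :> overalgebra A;
    bpt : forall a : A, pov a;
    bpt_op : forall (o : S) (a : 'I_(arity o) -> A),
      oop (fun i => bpt (a i)) = bpt (interp o a) }.

Record pointed_hom (S : signature) (A : algebra S)
    (P P' : pointed_overalgebra A) := PointedHom {
  phom_fun :> forall a : A, P a -> P' a;
  phom_op : forall (o : S) (a : 'I_(arity o) -> A) (p : forall i, P (a i)),
    phom_fun (oop p) = oop (fun i => phom_fun (p i));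
  phom_bpt : forall a : A, phom_fun (bpt P a) = bpt P' a }.

Record pointed_iso (S : signature) (A : algebra S)
    (P P' : pointed_overalgebra A) := PointedIso {
  iso_hom :> pointed_hom P P';
  iso_inv : pointed_hom P' P;
  iso_homK : forall a : A, cancel (@iso_hom a) (@iso_inv a);
  iso_invK : forall a : A, cancel (@iso_inv a) (@iso_hom a) }.

(* Additivity of [ab_op] is with respect to the product group
   [forall i, ab_fib (a i)]. *)
Record ab_overalgebra (S : signature) (A : algebra S) := AbOveralgebra {
  ab_fib :> A -> zmodType;
  ab_op : forall (o : S) (a : 'I_(arity o) -> A),
    (forall i, ab_fib (a i)) -> ab_fib (interp o a);
  ab_opD : forall (o : S) (a : 'I_(arity o) -> A) (p q : forall i, ab_fib (a i)),
    ab_op (fun i => p i + q i) = ab_op p + ab_op q }.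

Section AbPointed.
Variables (S : signature) (A : algebra S) (M : ab_overalgebra A).

Definition ab_ov : overalgebra A := @Overalgebra S A (fun a => M a) (@ab_op S A M).

Lemma ab_op0 (o : S) (a : 'I_(arity o) -> A) :
  @oop S A ab_ov o a (fun i => 0 : M (a i)) = (0 : M (interp o a)).
Proof.
have := ab_opD (fun i => 0 : M (a i)) (fun i => 0 : M (a i)).
have -> : (fun i => (0 : M (a i)) + 0) = (fun i => 0 : M (a i)).
  by apply: functional_extensionality_dep => i; rewrite addr0.
by move/eqP; rewrite -subr_eq subrr eq_sym => /eqP.
Qed.

Definition ab_pointed : pointed_overalgebra A :=
  @PointedOveralgebra S A ab_ov (fun a => 0 : M a) ab_op0.

End AbPointed.

Section Restriction.
Variables (S : signature) (X A : algebra S) (f : hom X A).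

(* [oop q] lies over [interp o (f \o x)], which is only propositionally equal
   to [f (interp o x)]; hence the transport. *)
Definition res (Q : overalgebra A) : overalgebra X :=
  @Overalgebra S X (fun x => Q (f x)) (fun o x q =>
    ecast a (Q a) (esym (hom_op f x)) (oop q)).

Lemma res_bpt_op (P : pointed_overalgebra A) (o : S) (x : 'I_(arity o) -> X) :
  @oop S X (res P) o x (fun i => bpt P (f (x i))) = bpt P (f (interp o x)).
Proof. by rewrite /= bpt_op; case: _ / (esym (hom_op f x)). Qed.

Definition res_pointed (P : pointed_overalgebra A) : pointed_overalgebra X :=
  @PointedOveralgebra S X (res P) (fun x => bpt P (f x)) (res_bpt_op P).

End Restriction.

Section Star.
Variables (S : signature) (E : algebra S) (kappa : congruence E).

Definition star_ov : overalgebra E :=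
  @Overalgebra S E (fun e => {e' : E | kappa e e'}) (fun o e c =>
    exist (kappa (interp o e)) (interp o (fun i => sval (c i)))
          (cong_op (fun i => svalP (c i)))).

Definition star_bpt (e : E) : star_ov e :=
  exist (kappa e) e (@Equivalence_Reflexive _ _ (cong_equiv kappa) e).

Lemma star_bpt_op (o : S) (e : 'I_(arity o) -> E) :
  oop (fun i => star_bpt (e i)) = star_bpt (interp o e).
Proof. exact: eq_exist. Qed.

Definition star : pointed_overalgebra E := PointedOveralgebra star_bpt_op.

End Star.

Record extension (S : signature) (V : algebra S -> Prop) (A : algebra S)
    (M : ab_overalgebra A) := Extension {
  ext_alg : algebra S;
  ext_in : V ext_alg;
  ext_pi : hom ext_alg A;
  ext_onto : forall a : A, exists e : ext_alg, ext_pi e = a;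
  ext_chi :
    pointed_iso (res_pointed ext_pi (ab_pointed M)) (star (kernel ext_pi)) }.

Definition chi_inv (S : signature) (V : algebra S -> Prop) (A : algebra S)
    (M : ab_overalgebra A) (X : extension V M) (e e' : ext_alg X)
    (h : ext_pi X e = ext_pi X e') : M (ext_pi X e) :=
  @iso_inv _ _ _ _ (ext_chi X) e
    (exist (fun e1 => ext_pi X e = ext_pi X e1) e' h).

(* Main.v *)
Require Import Defs.
From mathcomp Require Import all_boot all_algebra boolp.
Import Defs.
Import GRing.Theory.
Local Open Scope ring_scope.

Set Implicit Arguments.
Unset Strict Implicit.
Unset Printing Implicit Defensive.

(** For [e], [e'], [e''] in one fiber of [ext_pi X], the defect
    [chi_inv (e, e') + chi_inv (e', e'') - chi_inv (e, e'')] is the value of a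
    homomorphism [defect_hom] from the algebra [triples] of all such triples to
    the total algebra of [M]: [chi] and the addition of [M] both commute with
    the operations.  The defect vanishes as soon as [e = e'] or [e' = e''],
    because [chi] matches the zero of [M] with the basepoint.  Modularity forces
    such a homomorphism to be zero everywhere.  Indeed, consider the
    rectangle in [triples]
<<
        (e', e', e') --- (e', e', e'')
             |                |
        (e,  e', e') --- (e,  e', e'')
>>
    whose horizontal sides change only the last coordinate and whose vertical
    sides change only the first one.  A congruence relating the ends of the top
    side relates the ends of the bottom side, by Gumm's shifting lemma
    ([shifting_lemma]).  The kernel of the defect relates the ends of the top
    side, where the defect is zero on both; so the defect of [(e, e', e'')] is
    that of [(e, e', e')], which is zero.  The shifting lemma needs modularity
    of the congruences of [triples]; this algebra belongs to the variety as
    a subalgebra of the cube of [ext_alg X] ([variety_separated]). *)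

(** * Varieties and modular congruence lattices *)

Section Algebras.
Variable S : signature.
Implicit Types A B E : algebra S.

Lemma eval_hom B E (f : hom B E) (v : nat -> B) (t : term S) :
  f (eval v t) = eval (fun n => f (v n)) t.
Proof.
elim: t => //= o ts IH; rewrite hom_op; congr (interp o _).
exact: functional_extensionality_dep.
Qed.

(** Such a [B] embeds into a power of [E], namely the one indexed by the
    homomorphisms from [B] to [E], so this is closure of [V] under subalgebras
    and powers without building either. *)
Lemma variety_separated (V : algebra S -> Prop) (hV : variety V) B E :
  (forall x y : B, (forall f : hom B E, f x = f y) -> x = y) -> V E -> V B.
Proof.
have [Sigma VP] := hV; move=> sep /VP VE; apply/VP => s t st v.
by apply: sep => f; rewrite !eval_hom; apply: VE.
Qed.

(** The path [z], [x], [y], [w] shows that [(z, w)] is in the join of [beta] and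
    the meet of [alpha] and [gamma]; it is also in [alpha].  Since that meet is
    below [alpha], modularity puts [(z, w)] in the join of the same meet with
    the meet of [beta] and [alpha], and both are below [gamma]. *)
Lemma shifting_lemma E (alpha beta gamma : congruence E) (x y z w : E) :
  modular_congruences E -> cong_le (cong_meet beta alpha) gamma ->
  alpha x y -> alpha z w -> beta x z -> beta y w -> gamma x y -> gamma z w.
Proof.
move=> modE le_g axy azw bxz byw gxy.
have le_a : cong_le (cong_meet alpha gamma) alpha by move=> ? ? [].
have [_ shift] := modE (cong_meet alpha gamma) beta alpha le_a z w.
have zw : cong_meet (cong_join (cong_meet alpha gamma) beta) alpha z w.
  split=> // U agU bU; have [_ symU transU] := cong_equiv U.
  apply: (transU _ x); first exact/symU/bU.
  by apply: (transU _ y); [apply: agU | apply: bU].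
by apply: (shift zw) => // ? ? [].
Qed.

(** * Triples in a fiber *)

Section Triples.
Variables (E A : algebra S) (p : hom E A).

Record triple := Triple {
  t1 : E; t2 : E; t3 : E;
  t12 : p t1 = p t2;
  t23 : p t2 = p t3 }.

Lemma triple_eq (x y : triple) :
  t1 x = t1 y -> t2 x = t2 y -> t3 x = t3 y -> x = y.
Proof.
case: x y => [a b c h k] [a' b' c' h' k'] /= eqa eqb eqc.
case: a' / eqa h'; case: b' / eqb k'; case: c' / eqc => k' h'.
by rewrite (Prop_irrelevance h h') (Prop_irrelevance k k').
Qed.

Definition triples : algebra S := @Algebra S triple (fun o x =>
  @Triple (interp o (fun i => t1 (x i)))
          (interp o (fun i => t2 (x i)))
          (interp o (fun i => t3 (x i)))
          (kernel_op (fun i => t12 (x i)))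
          (kernel_op (fun i => t23 (x i)))).

Definition t1_hom : hom triples E := @Hom S triples E t1 (fun _ _ => erefl).
Definition t2_hom : hom triples E := @Hom S triples E t2 (fun _ _ => erefl).
Definition t3_hom : hom triples E := @Hom S triples E t3 (fun _ _ => erefl).

Lemma triples_in (V : algebra S -> Prop) : variety V -> V E -> V triples.
Proof.
move=> hV; apply: (variety_separated hV) => x y xy.
by apply: triple_eq; [apply: (xy t1_hom)|apply: (xy t2_hom)|apply: (xy t3_hom)].
Qed.

(** The two congruences that forget only the last, resp. only the first,
    coordinate meet in equality, so the shifting lemma applies to them with any
    third congruence, here the kernel of [g]. *)
Lemma triples_shift (B : algebra S) (g : hom triples B) (e e' e'' : E)
    (h : p e = p e') (h' : p e' = p e'') :
  modular_congruences triples ->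
  g (@Triple e' e' e' erefl erefl) = g (@Triple e' e' e'' erefl h') ->
  g (@Triple e e' e' h erefl) = g (@Triple e e' e'' h h').
Proof.
move=> modT.
apply: (shifting_lemma (alpha := cong_meet (kernel t1_hom) (kernel t2_hom))
  (beta := cong_meet (kernel t2_hom) (kernel t3_hom))
  (gamma := kernel g) modT) => //.
move=> x y [[/= eq2 eq3] [/= eq1 _]].
by rewrite (triple_eq eq1 eq2 eq3).
Qed.

End Triples.
End Algebras.

(** * Operations of an abelian group overalgebra *)

Section AbOps.
Variables (S : signature) (A : algebra S) (M : ab_overalgebra A).

Lemma existT_ecast (a b : A) (h : a = b) (m : M a) :
  existT (fun a => M a) b (ecast a (M a) h m) = existT (fun a => M a) a m.
Proof. by case: b / h. Qed.

Lemma ecastD (a b : A) (h : a = b) (m n : M a) :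
  ecast a (M a) h (m + n) = ecast a (M a) h m + ecast a (M a) h n.
Proof. by case: b / h. Qed.

Lemma ecastN (a b : A) (h : a = b) (m : M a) :
  ecast a (M a) h (- m) = - ecast a (M a) h m.
Proof. by case: b / h. Qed.

Lemma ecast0 (a b : A) (h : a = b) : ecast a (M a) h 0 = 0.
Proof. by case: b / h. Qed.

Lemma ecast_trans (a b c : A) (h : a = b) (k : b = c) (l : a = c) (m : M a) :
  ecast a (M a) k (ecast a (M a) h m) = ecast a (M a) l m.
Proof. by case: c / k l => l; rewrite (Prop_irrelevance l h). Qed.

(** The casts on the arguments can be of any form: once [a] and [b] are
    identified, proof irrelevance makes all of them trivial. *)
Lemma ab_op_ecast (o : S) (a b : 'I_(arity o) -> A) (h : forall i, a i = b i)
    (H : interp o a = interp o b) (m : forall i, M (a i)) :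
  ab_op (fun i => ecast a (M a) (h i) (m i)) = ecast a (M a) H (ab_op m).
Proof.
have eqab : a = b by apply: functional_extensionality_dep.
case: b / eqab h H => h H; rewrite (Prop_irrelevance H erefl) /=.
congr ab_op; apply: functional_extensionality_dep => i.
by rewrite (Prop_irrelevance (h i) erefl).
Qed.

Lemma ab_opN (o : S) (a : 'I_(arity o) -> A) (m : forall i, M (a i)) :
  ab_op (fun i => - m i) = - ab_op m.
Proof.
apply/eqP; rewrite -addr_eq0 -ab_opD; apply/eqP.
rewrite -[RHS](ab_op0 M a) /=; congr ab_op.
by apply: functional_extensionality_dep => i; rewrite addNr.
Qed.

End AbOps.

(** * The defect of additivity *)

Section Defect.
Variables (S : signature) (V : algebra S -> Prop) (A : algebra S).
Variables (M : ab_overalgebra A) (X : extension V M).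
Let E := ext_alg X.
Let p : hom E A := ext_pi X.

(** The inverse of [chi] preserves basepoints, which are [e] on one side and zero
    on the other. *)
Lemma chi_inv_refl (e : E) (h : p e = p e) : chi_inv h = 0.
Proof.
rewrite -[RHS](phom_bpt (iso_inv (ext_chi X)) e).
by apply: (congr1 (@phom_fun _ _ _ _ (iso_inv (ext_chi X)) e)); apply: eq_exist.
Qed.

Lemma chi_inv_op (o : S) (x y : 'I_(arity o) -> E)
    (h : forall i, p (x i) = p (y i)) (H : p (interp o x) = p (interp o y)) :
  chi_inv H =
    ecast a (M a) (esym (hom_op p x)) (ab_op (fun i => chi_inv (h i))).
Proof.
rewrite -[RHS](phom_op (iso_inv (ext_chi X))
  (fun i => exist (fun e => p (x i) = p e) (y i) (h i))).
by apply: (congr1 (@phom_fun _ _ _ _ (iso_inv (ext_chi X)) _)); apply: eq_exist.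
Qed.

Definition defect (t : triple p) : M (p (t1 t)) :=
  chi_inv (t12 t) + ecast a (M a) (esym (t12 t)) (chi_inv (t23 t))
  - chi_inv (etrans (t12 t) (t23 t)).

(** Values over different elements of [A] are only comparable in the total
    algebra, hence the pairing with the base point of the fiber. *)
Definition defect_fun (t : triples p) : total_algebra (ab_ov M) :=
  existT (fun a => M a) (p (t1 t)) (defect t).

(** Each of the three terms of the defect commutes with the operations by
    [chi_inv_op], and [ab_op] is additive; what remains is to see that the
    casts compose to the same one. *)
Lemma defect_op (o : S) (x : 'I_(arity o) -> triples p) :
  defect_fun (interp o x) = interp o (fun i => defect_fun (x i)).
Proof.
set y1 := fun i => t1 (x i); set y2 := fun i => t2 (x i).
have eq12 : interp o (fun i => p (y2 i)) = interp o (fun i => p (y1 i)).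
  congr (interp o _); apply: functional_extensionality_dep => i.
  exact/esym/(t12 (x i)).
rewrite /= /defect_fun /=.
rewrite -[RHS](existT_ecast (esym (hom_op p y1))).
congr (existT _ _ _); rewrite /defect /=.
rewrite (chi_inv_op (fun i => t12 (x i))).
rewrite (chi_inv_op (fun i => t23 (x i))).
rewrite (chi_inv_op (fun i => etrans (t12 (x i)) (t23 (x i)))).
rewrite !ab_opD ab_opN !ecastD ecastN.
rewrite (ab_op_ecast (fun i => esym (t12 (x i))) eq12).
congr (_ + _ - _).
rewrite (ecast_trans _ _ (etrans eq12 (esym (hom_op p y1)))).
by rewrite (ecast_trans _ _ (etrans eq12 (esym (hom_op p y1)))).
Qed.

Definition defect_hom : hom (triples p) (total_algebra (ab_ov M)) :=
  Hom defect_op.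

Lemma defect_left (e e' : E) (h : p e = p e') :
  defect (@Triple _ _ _ p e e e' erefl h) = 0.
Proof.
rewrite /defect /= chi_inv_refl add0r.
by rewrite (Prop_irrelevance (etrans erefl h) h) subrr.
Qed.

Lemma defect_right (e e' : E) (h : p e = p e') :
  defect (@Triple _ _ _ p e e' e' h erefl) = 0.
Proof. by rewrite /defect /= chi_inv_refl ecast0 addr0 subrr. Qed.

End Defect.

(* The summand [chi_inv h'] lies in [M (ext_pi X e')] and is transported to
   [M (ext_pi X e)] along [h]. *)
Theorem lemma3p2 (S : signature) (V : algebra S -> Prop)
    (hV : variety V) (hmod : congruence_modular V)
    (A : algebra S) (hA : V A)
    (M : ab_overalgebra A) (hM : totally_in V (ab_ov M))
    (X : extension V M) (e e' e'' : ext_alg X)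
    (h : ext_pi X e = ext_pi X e') (h' : ext_pi X e' = ext_pi X e'') :
  chi_inv h + ecast a (M a) (esym h) (chi_inv h') = chi_inv (etrans h h').
Proof.
have modT := hmod _ (triples_in (ext_pi X) hV (ext_in X)).
have top : defect_hom X (@Triple _ _ _ (ext_pi X) e' e' e' erefl erefl) =
           defect_hom X (@Triple _ _ _ (ext_pi X) e' e' e'' erefl h').
  by rewrite /= /defect_fun !defect_left.
have := triples_shift (g := defect_hom X) h modT top.
rewrite /= /defect_fun defect_right => bottom.
(* Both pairs lie over [ext_pi X e], so their second components agree. *)
have /esym defect0 := projT2_eq bottom.
move: defect0; rewrite (Prop_irrelevance (projT1_eq bottom) erefl) /=.
by move/eqP; rewrite subr_eq0 => /eqP.
Qed.
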